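(* Let $f_1,\dots,f_m:\mathbb{R}^n\to\mathbb{R}$ be convex and aligned, let $\mathbf{x}_\star\in C_\star$, let $\mathbf{x}_1\in\mathbb{R}^n$ and $K\ge 1$, and let $\bar{\mathbf{x}}$ be the output of the PAMOO algorithm after $K$ iterations started at $\mathbf{x}_1$. Then: (1) if all $f_i$ are $G$-Lipschitz, $\displaystyle \max_{i\in[m]}\big(f_i(\bar{\mathbf{x}})-f_i^\star\big)\le \frac{G\,\|\mathbf{x}_1-\mathbf{x}_\star\|}{\sqrt K}$; (2) if all $f_i$ are $\beta$-smooth, $\displaystyle \max_{i\in[m]}\big(f_i(\bar{\mathbf{x}})-f_i^\star\big)\le \frac{2\beta\,\|\mathbf{x}_1-\mathbf{x}_\star\|^2}{K}$.
   Context: $\|\cdot\|$ is the Euclidean norm; each $f_i$ attains its minimum $f_i^\star=\min_{\mathbf{x}\in\mathbb{R}^n}f_i(\mathbf{x})$. Aligned means that $C_\star=\{\mathbf{x}\in\mathbb{R}^n: f_i(\mathbf{x})=f_i^\star\ \forall i\in[m]\}$ is non-empty. $\nabla f(\mathbf{x})$ is the gradient (a fixed choice of subgradient at points of non-differentiability). $f$ is $G$-Lipschitz if $\|\nabla f(\mathbf{x})\|\le G$ for all $\mathbf{x}$; $f$ is $\beta$-smooth if $f(\mathbf{y})\le f(\mathbf{x})+\nabla f(\mathbf{x})^\top(\mathbf{y}-\mathbf{x})+\frac\beta2\|\mathbf{x}-\mathbf{y}\|^2$ for all $\mathbf{x},\mathbf{y}$. For $\mathbf{w}\in\mathbb{R}^m_+$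 (non-negative entries), $f_{\mathbf{w}}=\sum_i w_if_i$ and $\nabla f_{\mathbf{w}}=\sum_i w_i\nabla f_i$. PAMOO algorithm (knows $f_1^\star,\dots,f_m^\star$): for $k=1,\dots,K$, set $\Delta_k=[f_1(\mathbf{x}_k)-f_1^\star,\dots,f_m(\mathbf{x}_k)-f_m^\star]^\top$, $J_k=[\nabla f_1(\mathbf{x}_k)\ \cdots\ \nabla f_m(\mathbf{x}_k)]\in\mathbb{R}^{n\times m}$, choose any $\mathbf{w}_k\in\arg\max_{\mathbf{w}\in\mathbb{R}^m_+}\big(2\mathbf{w}^\top\Delta_k-\mathbf{w}^\top J_k^\top J_k\mathbf{w}\big)$, and set $\mathbf{x}_{k+1}=\mathbf{x}_k-\nabla f_{\mathbf{w}_k}(\mathbf{x}_k)$. Output $\bar{\mathbf{x}}=\frac1K\sum_{k=1}^K\mathbf{x}_k$. *)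

(* Defs.v *)
From HB Require Import structures.
From mathcomp Require Export all_boot all_order all_algebra.
From mathcomp Require Export all_classical all_reals all_analysis.
Export numFieldNormedType.Exports.
Export Order.TTheory GRing.Theory Num.Theory.
Set Implicit Arguments.
Unset Strict Implicit.
Unset Printing Implicit Defensive.
Local Open Scope classical_set_scope.
Local Open Scope ring_scope.

Definition dot (R : realType) (n : nat) (u v : 'cV[R]_n) : R :=
  (u^T *m v) 0 0.

(* The canonical norm `|u| on matrices is the sup norm, hence this one. It
   induces the same topology, so [differentiable] is Frechet differentiability
   on the Euclidean space R^n. *)
Definition enorm (R : realType) (n : nat) (u : 'cV[R]_n) : R :=
  Num.sqrt (dot u u).

Definition convex_fun (R : realType) (n : nat) (f : 'cV[R]_n -> R) : Prop :=
  convex_function [set: 'cV[R]_n] f.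

Definition is_min (R : realType) (n : nat) (f : 'cV[R]_n -> R) (v : R) : Prop :=
  (exists x, f x = v) /\ (forall x, v <= f x).

Definition common_minimizers (R : realType) (n m : nat)
    (f : 'I_m -> 'cV[R]_n -> R) (fstar : 'I_m -> R) : set 'cV[R]_n :=
  [set x | forall i, f i x = fstar i].

Definition aligned (R : realType) (n m : nat)
    (f : 'I_m -> 'cV[R]_n -> R) (fstar : 'I_m -> R) : Prop :=
  common_minimizers f fstar !=set0.

Definition gradient (R : realType) (n : nat) (f : 'cV[R]_n -> R)
    (x : 'cV[R]_n) : 'cV[R]_n :=
  \col_i 'D_(delta_mx i 0) (f : 'cV[R]_n -> R^o) x.

Definition subgradient (R : realType) (n : nat) (f : 'cV[R]_n -> R)
    (x : 'cV[R]_n) : set 'cV[R]_n :=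
  [set v | forall y, f x + dot v (y - x) <= f y].

(* [g] is an admissible meaning of "nabla f": the gradient wherever [f] is
   differentiable, and some fixed subgradient at every other point. *)
Definition is_nabla (R : realType) (n : nat) (f : 'cV[R]_n -> R)
    (g : 'cV[R]_n -> 'cV[R]_n) : Prop :=
  forall x,
    (differentiable (f : 'cV[R]_n -> R^o) x -> g x = gradient f x) /\
    (~ differentiable (f : 'cV[R]_n -> R^o) x -> subgradient f x (g x)).

(* G-Lipschitz is understood as a bound on the chosen (sub)gradients. *)
Definition nabla_lipschitz (R : realType) (n : nat)
    (g : 'cV[R]_n -> 'cV[R]_n) (G : R) : Prop :=
  forall x, enorm (g x) <= G.

Definition nabla_smooth (R : realType) (n : nat) (f : 'cV[R]_n -> R)
    (g : 'cV[R]_n -> 'cV[R]_n) (beta : R) : Prop :=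
  forall x y,
    f y <= f x + dot (g x) (y - x) + beta / 2 * enorm (x - y) ^+ 2.

Definition nonneg_vectors (R : realType) (m : nat) : set 'cV[R]_m :=
  [set w | forall i, 0 <= w i 0].

Definition argmax (R : realType) (T : Type) (A : set T) (F : T -> R) : set T :=
  [set w | A w /\ forall w', A w' -> F w' <= F w].

Definition nabla_w (R : realType) (n m : nat)
    (g : 'I_m -> 'cV[R]_n -> 'cV[R]_n) (w : 'cV[R]_m) (x : 'cV[R]_n) :
    'cV[R]_n :=
  \sum_(i < m) w i 0 *: g i x.

Definition gaps (R : realType) (n m : nat) (f : 'I_m -> 'cV[R]_n -> R)
    (fstar : 'I_m -> R) (x : 'cV[R]_n) : 'cV[R]_m :=
  \col_i (f i x - fstar i).

Definition nabla_matrix (R : realType) (n m : nat)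
    (g : 'I_m -> 'cV[R]_n -> 'cV[R]_n) (x : 'cV[R]_n) : 'M[R]_(n, m) :=
  \matrix_(j < n, i < m) g i x j 0.

Definition pamoo_objective (R : realType) (n m : nat)
    (f : 'I_m -> 'cV[R]_n -> R) (fstar : 'I_m -> R)
    (g : 'I_m -> 'cV[R]_n -> 'cV[R]_n) (x : 'cV[R]_n) (w : 'cV[R]_m) : R :=
  let J := nabla_matrix g x in
  2 * (w^T *m gaps f fstar x) 0 0 - (w^T *m J^T *m J *m w) 0 0.

(* [x] and [w] are the iterates x_1, ..., x_(K+1) and weights w_1, ..., w_K of
   a run of K iterations; their values at other indices are irrelevant. *)
Definition pamoo_run (R : realType) (n m : nat)
    (f : 'I_m -> 'cV[R]_n -> R) (fstar : 'I_m -> R)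
    (g : 'I_m -> 'cV[R]_n -> 'cV[R]_n) (x1 : 'cV[R]_n) (K : nat)
    (x : nat -> 'cV[R]_n) (w : nat -> 'cV[R]_m) : Prop :=
  x 1%N = x1 /\
  forall k, (1 <= k <= K)%N ->
    argmax (@nonneg_vectors R m) (pamoo_objective f fstar g (x k)) (w k) /\
    x k.+1 = x k - nabla_w g (w k) (x k).

Definition pamoo_output (R : realType) (n K : nat) (x : nat -> 'cV[R]_n) :
    'cV[R]_n :=
  K%:R^-1 *: \sum_(1 <= k < K.+1) x k.

(* The index set must be nonempty for the maximum to make sense. *)
Definition max_ord (R : realType) (m : nat) (F : 'I_m.+1 -> R) : R :=
  \big[Num.max/F ord0]_(i < m.+1) F i.

(* Main.v *)
(* The subgradient inequality at [xstar] gives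
     |x_(k+1) - xstar|^2 <= |x_k - xstar|^2 - (PAMOO objective at w_k),
   and by maximality of [w_k] the objective at [w_k] dominates its value
   2 t delta_k - t^2 |nabla f_i (x_k)|^2 at [t] times the [i]-th basis vector,
   where delta_k = f_i (x_k) - fstar_i. Telescoping bounds the sum of these
   values by |x_1 - xstar|^2, and K (f_i (xbar) - fstar_i) <= sum_k delta_k by
   convexity. It remains to pick [t]: t = (f_i (xbar) - fstar_i) / G^2 in the
   Lipschitz case, and t = 1 / (2 beta) in the smooth case, where
   |nabla f_i|^2 <= 2 beta delta_k. *)
Require Import Defs.
From mathcomp Require Import ring lra.
Set Implicit Arguments.
Unset Strict Implicit.
Unset Printing Implicit Defensive.
Local Open Scope classical_set_scope.
Local Open Scope ring_scope.

(** * Euclidean inner product and norm *)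

Lemma dotE (R : realType) (n : nat) (u v : 'cV[R]_n) :
  dot u v = \sum_i u i 0 * v i 0.
Proof. by rewrite /dot mxE; apply: eq_bigr => i _; rewrite mxE. Qed.

Lemma dotC (R : realType) (n : nat) (u v : 'cV[R]_n) : dot u v = dot v u.
Proof. by rewrite !dotE; apply: eq_bigr => i _; rewrite mulrC. Qed.

Lemma dotDr (R : realType) (n : nat) (u v w : 'cV[R]_n) :
  dot u (v + w) = dot u v + dot u w.
Proof. by rewrite /dot mulmxDr mxE. Qed.

Lemma dotZr (R : realType) (n : nat) (u v : 'cV[R]_n) (a : R) :
  dot u (a *: v) = a * dot u v.
Proof. by rewrite /dot -scalemxAr mxE. Qed.

Lemma dotNr (R : realType) (n : nat) (u v : 'cV[R]_n) :
  dot u (- v) = - dot u v.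
Proof. by rewrite -scaleN1r dotZr mulN1r. Qed.

Lemma dotDl (R : realType) (n : nat) (u v w : 'cV[R]_n) :
  dot (u + v) w = dot u w + dot v w.
Proof. by rewrite dotC dotDr !(dotC w). Qed.

Lemma dotZl (R : realType) (n : nat) (u v : 'cV[R]_n) (a : R) :
  dot (a *: u) v = a * dot u v.
Proof. by rewrite dotC dotZr dotC. Qed.

Lemma dotNl (R : realType) (n : nat) (u v : 'cV[R]_n) :
  dot (- u) v = - dot u v.
Proof. by rewrite dotC dotNr dotC. Qed.

Lemma dot_sumr (R : realType) (n : nat) (I : Type) (r : seq I)
    (u : 'cV[R]_n) (v : I -> 'cV[R]_n) :
  dot u (\sum_(i <- r) v i) = \sum_(i <- r) dot u (v i).
Proof.
by apply: (big_morph (dot u) (dotDr u)); rewrite /dot mulmx0 mxE.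
Qed.

Lemma dot_ge0 (R : realType) (n : nat) (u : 'cV[R]_n) : 0 <= dot u u.
Proof. by rewrite dotE; apply: sumr_ge0 => i _; rewrite -expr2 sqr_ge0. Qed.

Lemma dot_eq0 (R : realType) (n : nat) (u : 'cV[R]_n) :
  (dot u u == 0) = (u == 0).
Proof.
apply/eqP/eqP => [|->]; last by rewrite /dot mulmx0 mxE.
rewrite dotE => /psumr_eq0P H; apply/colP => i; rewrite mxE.
apply/eqP; rewrite -sqrf_eq0 expr2; apply/eqP/H => // j _.
by rewrite -expr2 sqr_ge0.
Qed.

Lemma enorm_sqr (R : realType) (n : nat) (u : 'cV[R]_n) :
  enorm u ^+ 2 = dot u u.
Proof. by rewrite sqr_sqrtr ?dot_ge0. Qed.

Lemma enorm_ge0 (R : realType) (n : nat) (u : 'cV[R]_n) : 0 <= enorm u.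
Proof. exact: sqrtr_ge0. Qed.

(** * Gradients and subgradients of convex functions *)

Lemma derive_dot_gradient (R : realType) (n : nat) (f : 'cV[R]_n -> R)
    (x v : 'cV[R]_n) :
  differentiable (f : 'cV[R]_n -> R^o) x ->
  'D_v (f : 'cV[R]_n -> R^o) x = dot (gradient f x) v.
Proof.
move=> df; rewrite deriveE // {1}[v]matrix_sum_delta.
under eq_bigr do rewrite big_ord1.
rewrite linear_sum dotE; apply: eq_bigr => i _.
by rewrite linearZ /gradient mxE deriveE // mulrC.
Qed.

(** By convexity every difference quotient at [x] along [y - x] with step in (0, 1] is at most
    [f y - f x]; the bound passes to the right limit at 0, the directional derivative. *)
Lemma gradient_subgradient (R : realType) (n : nat) (f : 'cV[R]_n -> R)
    (x : 'cV[R]_n) :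
  convex_fun f -> differentiable (f : 'cV[R]_n -> R^o) x ->
  subgradient f x (gradient f x).
Proof.
move=> cf df y; rewrite -derive_dot_gradient // -lerBrDl.
have /cvg_dnbhs_at_right := diff_derivable (v := y - x) df.
move=> /cvgr_to_le; apply.
near=> h.
have h0 : 0 < h by near: h; exact: nbhs_right_gt.
have h1 : h <= 1 by near: h; exact: nbhs_right_le.
have := cf (Itv01 (ltW h0) h1) y x; rewrite !inE => /(_ Logic.I Logic.I).
rewrite [leRHS]convRE => fyx.
have {}fyx : f (h *: y + (1 - h) *: x) <= h * f y + (1 - h) * f x := fyx.
rewrite /= [_ *: _]mulrC ler_pdivrMr //.
have -> : h *: (y - x) + x = h *: y + (1 - h) *: x.
  by rewrite scalerBr scalerBl scale1r -addrA [- _ + x]addrC.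
lra.
Unshelve. all: by end_near.
Qed.

Lemma nabla_subgradient (R : realType) (n : nat) (f : 'cV[R]_n -> R)
    (g : 'cV[R]_n -> 'cV[R]_n) (x : 'cV[R]_n) :
  convex_fun f -> is_nabla f g -> subgradient f x (g x).
Proof.
move=> cf /(_ x) [gd gn].
have [df|ndf] := pselect (differentiable (f : 'cV[R]_n -> R^o) x).
  by rewrite gd //; exact: gradient_subgradient.
exact: gn.
Qed.

(** Jensen's inequality: in the sum of the subgradient inequalities at the mean, the linear terms
    cancel because the deviations from the mean add up to zero. *)
Lemma subgradient_mean_le (R : realType) (n K : nat) (f : 'cV[R]_n -> R)
    (x : nat -> 'cV[R]_n) (v : 'cV[R]_n) (c : R) :
  (1 <= K)%N -> subgradient f (pamoo_output K x) v ->
  K%:R * (f (pamoo_output K x) - c) <= \sum_(1 <= k < K.+1) (f (x k) - c).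
Proof.
move=> hK sub; set y := pamoo_output K x in sub *.
have K0 : K%:R != 0 :> R by rewrite pnatr_eq0 -lt0n.
have dev0 : \sum_(1 <= k < K.+1) dot v (x k - y) = 0.
  rewrite -dot_sumr sumrB sumr_const_nat subn1 /= -[y *+ K]scaler_nat.
  by rewrite scalerA mulfV // scale1r subrr /dot mulmx0 mxE.
have -> : K%:R * (f y - c) =
    \sum_(1 <= k < K.+1) (f y - c + dot v (x k - y)).
  by rewrite big_split /= dev0 addr0 sumr_const_nat subn1 mulr_natl.
apply: ler_sum => k _; have := sub (x k); lra.
Qed.

(** * The PAMOO objective and the telescoped bound *)

Lemma pamoo_objectiveE (R : realType) (n m : nat) (f : 'I_m -> 'cV[R]_n -> R)
    (fstar : 'I_m -> R) (g : 'I_m -> 'cV[R]_n -> 'cV[R]_n) (x : 'cV[R]_n)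
    (w : 'cV[R]_m) :
  pamoo_objective f fstar g x w =
  2 * (\sum_i w i 0 * (f i x - fstar i))
    - dot (nabla_w g w x) (nabla_w g w x).
Proof.
have Jw : nabla_matrix g x *m w = nabla_w g w x.
  apply/colP => j; rewrite mxE summxE; apply: eq_bigr => i _.
  by rewrite !mxE mulrC.
rewrite /pamoo_objective -[w^T *m _ *m _ *m _]mulmxA Jw -trmx_mul Jw.
congr (2 * _ - _); rewrite mxE; apply: eq_bigr => i _.
by rewrite !mxE.
Qed.

Lemma pamoo_objective_delta (R : realType) (n m : nat)
    (f : 'I_m -> 'cV[R]_n -> R) (fstar : 'I_m -> R)
    (g : 'I_m -> 'cV[R]_n -> 'cV[R]_n) (x : 'cV[R]_n) (i : 'I_m) (t : R) :
  pamoo_objective f fstar g x (t *: delta_mx i 0) =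
  2 * t * (f i x - fstar i) - t ^+ 2 * dot (g i x) (g i x).
Proof.
have wE j : (t *: delta_mx i 0 : 'cV[R]_m) j 0 = t * (j == i)%:R.
  by rewrite !mxE eqxx andbT.
rewrite pamoo_objectiveE /nabla_w.
rewrite (bigD1 i) //= big1 => [|j /negPf ji]; last by rewrite wE ji mulr0 mul0r.
rewrite (bigD1 i) //= big1 => [|j /negPf ji]; last by rewrite wE ji mulr0 scale0r.
by rewrite wE eqxx mulr1 !addr0 dotZl dotZr; ring.
Qed.

(** With [v = nabla_w g w x], the right side expands to [2 * dot (x - xstar) v - dot v v].
    Nonnegative weights let the subgradient inequalities, tested at [xstar], be summed. *)
Lemma pamoo_step (R : realType) (n m : nat) (f : 'I_m -> 'cV[R]_n -> R)
    (fstar : 'I_m -> R) (g : 'I_m -> 'cV[R]_n -> 'cV[R]_n)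
    (x xstar : 'cV[R]_n) (w : 'cV[R]_m) :
  (forall i, subgradient (f i) x (g i x)) ->
  common_minimizers f fstar xstar -> nonneg_vectors w ->
  pamoo_objective f fstar g x w <=
    dot (x - xstar) (x - xstar)
    - dot (x - nabla_w g w x - xstar) (x - nabla_w g w x - xstar).
Proof.
move=> sub hx w0; rewrite pamoo_objectiveE.
have : \sum_i w i 0 * (f i x - fstar i) <= dot (x - xstar) (nabla_w g w x).
  rewrite dot_sumr; apply: ler_sum => i _; rewrite dotZr ler_wpM2l //.
  have := sub i xstar; rewrite hx -opprB dotNr dotC; lra.
rewrite [x - _ - _]addrAC; move: (x - xstar) (nabla_w g w x) => d v.
rewrite !(dotDl, dotDr, dotNl, dotNr) (dotC v d); lra.
Qed.

Lemma pamoo_regret (R : realType) (n m : nat) (f : 'I_m -> 'cV[R]_n -> R)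
    (fstar : 'I_m -> R) (g : 'I_m -> 'cV[R]_n -> 'cV[R]_n)
    (xstar x1 : 'cV[R]_n) (K : nat) (x : nat -> 'cV[R]_n)
    (w : nat -> 'cV[R]_m) (i : 'I_m) (t : R) :
  (forall i y, subgradient (f i) y (g i y)) ->
  common_minimizers f fstar xstar -> pamoo_run f fstar g x1 K x w -> 0 <= t ->
  \sum_(1 <= k < K.+1)
     (2 * t * (f i (x k) - fstar i) - t ^+ 2 * dot (g i (x k)) (g i (x k)))
  <= enorm (x1 - xstar) ^+ 2.
Proof.
move=> sub hx [x1E run] t0.
(* The sign makes the increments of [D] the decreases of the squared distance; after telescoping,
   the final distance is dropped as nonnegative. *)
pose D k := - dot (x k - xstar) (x k - xstar).
apply: (@le_trans _ _ (\sum_(1 <= k < K.+1) (D k.+1 - D k))); last first.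
  rewrite telescope_sumr // enorm_sqr /D x1E.
  by have := dot_ge0 (x K.+1 - xstar); lra.
rewrite big_nat [leRHS]big_nat; apply: ler_sum => k kK.
have [[w0 wmax] xS] := run k kK.
rewrite -(pamoo_objective_delta f).
have et0 : nonneg_vectors (t *: delta_mx i 0 : 'cV[R]_m).
  by move=> j; rewrite !mxE mulr_ge0.
apply: le_trans (wmax _ et0) _.
by rewrite /D xS addrC opprK; exact: pamoo_step.
Qed.

(** * The Lipschitz rate *)

Lemma pamoo_lipschitz (R : realType) (n m : nat) (f : 'I_m -> 'cV[R]_n -> R)
    (fstar : 'I_m -> R) (g : 'I_m -> 'cV[R]_n -> 'cV[R]_n)
    (xstar x1 : 'cV[R]_n) (K : nat) (x : nat -> 'cV[R]_n)
    (w : nat -> 'cV[R]_m) (i : 'I_m) (G : R) :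
  (1 <= K)%N -> (forall i y, subgradient (f i) y (g i y)) ->
  (forall y, fstar i <= f i y) -> common_minimizers f fstar xstar ->
  pamoo_run f fstar g x1 K x w -> nabla_lipschitz (g i) G ->
  f i (pamoo_output K x) - fstar i <= G * enorm (x1 - xstar) / Num.sqrt K%:R.
Proof.
move=> hK sub fmin hx run lip.
have K0 : 0 < K%:R :> R by rewrite ltr0n.
have sK0 : 0 < Num.sqrt K%:R :> R by rewrite sqrtr_gt0.
set a := _ - _; set d := enorm _.
have a0 : 0 <= a by rewrite subr_ge0.
have d0 : 0 <= d by exact: enorm_ge0.
have G0 : 0 <= G := le_trans (enorm_ge0 _) (lip 0).
rewrite ler_pdivlMr //.
(* The choice of [t] below divides by [G ^+ 2]. If [G = 0], the subgradient at the output vanishes,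
   so the output is a minimizer and [a = 0]. *)
have [G_eq0|Gn0] := eqVneq G 0.
  have g0 : g i (pamoo_output K x) = 0.
    apply/eqP; rewrite -dot_eq0 -enorm_sqr sqrf_eq0 eq_le enorm_ge0 andbT.
    by rewrite -G_eq0.
  have := sub i (pamoo_output K x) xstar; rewrite hx g0 /dot trmx0 mul0mx mxE.
  rewrite addr0 => fle; have -> : a = 0 by apply/le_anti; rewrite a0 subr_le0 fle.
  by rewrite G_eq0 !mul0r.
have Gpos : 0 < G by rewrite lt0r Gn0.
rewrite -(@ler_pXn2r _ 2) ?nnegrE ?mulr_ge0 ?sqrtr_ge0 //.
rewrite !exprMn sqr_sqrtr; last exact: ltW.
(* [t = a / G ^+ 2] maximizes [2 * t * a - t ^+ 2 * G ^+ 2], with value [a ^+ 2 / G ^+ 2]; [K] times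
   this value is what the squared goal requires. *)
have t0 : 0 <= a / G ^+ 2 by rewrite divr_ge0 ?sqr_ge0.
have := pamoo_regret i sub hx run t0; rewrite -/d => /(le_trans _) H.
rewrite mulrC -ler_pdivrMl ?exprn_gt0 //; apply: H.
have mean := subgradient_mean_le (fstar i) hK (sub i (pamoo_output K x)).
apply: (@le_trans _ _ (\sum_(1 <= k < K.+1)
    (2 * (a / G ^+ 2) * (f i (x k) - fstar i) - (a / G ^+ 2) ^+ 2 * G ^+ 2))).
  rewrite sumrB -mulr_sumr sumr_const_nat subn1 /= -[_ * _ *+ K]mulr_natl.
  apply: (@le_trans _ _ (2 * (a / G ^+ 2) * (K%:R * a) -
      K%:R * ((a / G ^+ 2) ^+ 2 * G ^+ 2))); last first.
    by rewrite lerD2r ler_wpM2l // mulr_ge0.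
  by rewrite le_eqVlt; apply/orP; left; apply/eqP; field.
apply: ler_sum => k _; rewrite lerD2l lerN2 ler_wpM2l ?sqr_ge0 // -enorm_sqr.
by rewrite ler_pXn2r ?nnegrE ?enorm_ge0.
Qed.

(** * The smooth rate *)

(** A gradient step of length [beta^-1] lowers [f] by at least [dot (g x) (g x) / (2 * beta)], yet
    cannot go below [v]. *)
Lemma nabla_smooth_sqr_le (R : realType) (n : nat) (f : 'cV[R]_n -> R)
    (g : 'cV[R]_n -> 'cV[R]_n) (beta v : R) (x : 'cV[R]_n) :
  0 < beta -> nabla_smooth f g beta -> (forall y, v <= f y) ->
  dot (g x) (g x) <= 2 * beta * (f x - v).
Proof.
move=> b0 smooth fmin.
have := smooth x (x - beta^-1 *: g x).
rewrite opprB [x + (_ - x)]addrC subrK [x - _ - x]addrAC subrr add0r.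
rewrite enorm_sqr dotNr !dotZr dotZl.
move=> /(le_trans (fmin _)); set N := dot _ _.
have -> : f x - beta^-1 * N + beta / 2 * (beta^-1 * (beta^-1 * N)) =
  f x - N / (2 * beta) by field; rewrite lt0r_neq0.
have b20 : 0 < 2 * beta by rewrite mulr_gt0.
rewrite lerBrDl -lerBrDr ler_pdivrMr // mulrC; exact.
Qed.

Lemma pamoo_smooth (R : realType) (n m : nat) (f : 'I_m -> 'cV[R]_n -> R)
    (fstar : 'I_m -> R) (g : 'I_m -> 'cV[R]_n -> 'cV[R]_n)
    (xstar x1 : 'cV[R]_n) (K : nat) (x : nat -> 'cV[R]_n)
    (w : nat -> 'cV[R]_m) (i : 'I_m) (beta : R) :
  (1 <= K)%N -> (forall i y, subgradient (f i) y (g i y)) ->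
  (forall y, fstar i <= f i y) -> common_minimizers f fstar xstar ->
  pamoo_run f fstar g x1 K x w -> 0 < beta -> nabla_smooth (f i) (g i) beta ->
  f i (pamoo_output K x) - fstar i <=
    2 * beta * enorm (x1 - xstar) ^+ 2 / K%:R.
Proof.
move=> hK sub fmin hx run b0 smooth.
have K0 : 0 < K%:R :> R by rewrite ltr0n.
have bn0 := lt0r_neq0 b0.
have b20 : 0 < 2 * beta by rewrite mulr_gt0.
rewrite ler_pdivlMr // -ler_pdivrMl // mulrC.
(* For a gap [D], the squared gradient is at most [2 * beta * D], so each summand is at least
   [2 * D * t * (1 - beta * t)]. This [t] maximizes that bound, giving [D / (2 * beta)]. *)
have t0 : 0 <= (2 * beta)^-1 by rewrite invr_ge0 ltW.
apply: le_trans (pamoo_regret i sub hx run t0).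
apply: (@le_trans _ _ (\sum_(1 <= k < K.+1)
    (f i (x k) - fstar i) / (2 * beta))).
  by rewrite -mulr_suml ler_wpM2r // mulrC; exact: subgradient_mean_le.
apply: ler_sum => k _.
have := nabla_smooth_sqr_le (x k) b0 smooth fmin.
move: (dot _ _) (f i (x k) - fstar i) => N D ND.
have : (2 * beta)^-1 ^+ 2 * N <= (2 * beta)^-1 ^+ 2 * (2 * beta * D).
  by rewrite ler_wpM2l // sqr_ge0.
have -> : (2 * beta)^-1 ^+ 2 * (2 * beta * D) = D / (2 * beta) by field.
have -> : 2 * (2 * beta)^-1 * D = 2 * (D / (2 * beta)) by field.
lra.
Qed.

(** * From single objectives to the maximum, and nonpositive [beta] *)

Lemma max_ord_le (R : realType) (m : nat) (F : 'I_m.+1 -> R) (b : R) :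
  (forall i, F i <= b) -> max_ord F <= b.
Proof. by move=> Fb; apply: bigmax_le. Qed.

Theorem theorem2 (R : realType) (n m : nat)
    (f : 'I_m.+1 -> 'cV[R]_n -> R) (fstar : 'I_m.+1 -> R)
    (g : 'I_m.+1 -> 'cV[R]_n -> 'cV[R]_n)
    (hconvex : forall i, convex_fun (f i))
    (hmin : forall i, is_min (f i) (fstar i))
    (haligned : aligned f fstar)
    (hnabla : forall i, is_nabla (f i) (g i))
    (xstar : 'cV[R]_n) (hxstar : common_minimizers f fstar xstar)
    (x1 : 'cV[R]_n) (K : nat) (hK : (1 <= K)%N)
    (x : nat -> 'cV[R]_n) (w : nat -> 'cV[R]_m.+1)
    (hrun : pamoo_run f fstar g x1 K x w) :
  (forall G : R, (forall i, nabla_lipschitz (g i) G) ->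
     max_ord (fun i => f i (pamoo_output K x) - fstar i)
       <= G * enorm (x1 - xstar) / Num.sqrt K%:R) /\
  (forall beta : R, (forall i, nabla_smooth (f i) (g i) beta) ->
     max_ord (fun i => f i (pamoo_output K x) - fstar i)
       <= 2 * beta * enorm (x1 - xstar) ^+ 2 / K%:R).
Proof.
have sub i y : subgradient (f i) y (g i y) by exact: nabla_subgradient.
have fmin i y : fstar i <= f i y by case: (hmin i).
split=> [G lip|beta smooth]; apply: max_ord_le => i.
  exact: (pamoo_lipschitz hK sub (fmin i) hxstar hrun (lip i)).
have [b0|b0] := ltP 0 beta.
  exact: (pamoo_smooth hK sub (fmin i) hxstar hrun b0 (smooth i)).
(* For [beta <= 0], smoothness and the subgradient inequality together force
   [beta * enorm (x1 - xstar) ^+ 2 = 0], while [f i] is [e]-smooth for all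
   [e > 0]. *)
have K0 : 0 < K%:R :> R by rewrite ltr0n.
have d0 : 0 <= enorm (x1 - xstar) ^+ 2 by exact: sqr_ge0.
have bd0 : 0 <= beta * enorm (x1 - xstar) ^+ 2.
  by have := smooth i x1 xstar; have := sub i x1 xstar; lra.
apply: (@le_trans _ _ 0); last by rewrite divr_ge0 ?ler0n // -mulrA mulr_ge0.
set d := enorm _ ^+ 2 in d0 *.
apply/ler_addgt0Pl => e e0; rewrite addr0.
have d1 : 0 < 2 * (d + 1) by lra.
(* Chosen so that the smooth rate for [b] is [e * (d / (d + 1))], which is at most [e]; using
   [d + 1] keeps the denominator positive when [d = 0]. As [beta <= 0 < b], smoothness carries over
   to [b]. *)
pose b := e * K%:R / (2 * (d + 1)).
have bpos : 0 < b by apply: divr_gt0 => //; exact: mulr_gt0.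
have smooth_b : nabla_smooth (f i) (g i) b.
  move=> y z; apply: le_trans (smooth i y z) _.
  by rewrite lerD2l ler_wpM2r ?sqr_ge0 //; lra.
apply: le_trans (pamoo_smooth hK sub (fmin i) hxstar hrun bpos smooth_b) _.
rewrite -/d ler_pdivrMr //.
have -> : 2 * b * d = e * K%:R * (d / (d + 1)).
  by rewrite /b; field; rewrite lt0r_neq0 //; lra.
by rewrite ler_piMr ?mulr_ge0 ?ltW // ltr_pdivrMr; lra.
Qed.
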